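(* For all integers $k$ and $m$ with $1 \leq m \leq k-1$, we have \[ f\left( n, k, \binom{k}{2} - m(k-m) - \binom{m}{2} + m + 1 \right) = \Omega\left(n^{1/m}\right), \] where $k$ and $m$ are fixed and the asymptotics are as $n\to\infty$.
   Context: For positive integers $p,q$ with $1\le q\le\binom p2$, a $(p,q)$-coloring of the complete graph $K_n$ is an edge-coloring of $K_n$ in which every set of $p$ vertices spans a clique whose edges receive at least $q$ distinct colors. $f(n,p,q)$ denotes the minimum number of colors in a $(p,q)$-coloring of $K_n$. Asymptotic notation is in $n$, with all other parameters treated as constants (implied constants may depend on them). *)

(* Defs.v *)
From HB Require Import structures.
From mathcomp Require Import all_boot all_order all_algebra.
From mathcomp Require Import all_classical all_reals all_analysis.

Set Implicit Arguments.
Unset Strict Implicit.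
Unset Printing Implicit Defensive.

Import Order.TTheory GRing.Theory Num.Theory.

Definition edge (V : finType) : finType := {e : {set V} | #|e| == 2}.

Section Coloring.
Variables (V C : finType).
Implicit Types (c : {ffun edge V -> C}) (S : {set V}).

Definition colors_in c S : {set C} := [set c e | e : edge V & val e \subset S].

Definition pq_coloring (p q : nat) c : bool :=
  [forall S : {set V}, (#|S| == p) ==> (q <= #|colors_in c S|)].

End Coloring.

(* K_n has a (p,q)-coloring with palette 'I_r.  Colors of the palette may be
   unused; this does not affect the least such r. *)
Definition pq_colorable (n p q r : nat) : bool :=
  [exists c : {ffun edge 'I_n -> 'I_r}, pq_coloring p q c].

(* The function f(n,p,q), as an extended real: its value is +oo when K_n has no
   (p,q)-coloring, which, for q <= 'C(p, 2), never happens (color the edges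
   with distinct colors).  Otherwise it is the least r in
   pq_colorable n p q (pq_number_min). *)
Definition pq_number (R : realType) (n p q : nat) : \bar R :=
  ereal_inf [set (r%:R%:E)%E | r in [set r | pq_colorable n p q r]]%classic.

Lemma pq_number_min (R : realType) (n p q r : nat) :
  pq_colorable n p q r ->
  (forall s, pq_colorable n p q s -> r <= s) ->
  pq_number R n p q = (r%:R%:E)%E.
Proof.
move=> Hr Hmin; apply/eqP; rewrite eq_le; apply/andP; split.
  by apply: ereal_inf_lbound; exists r.
by apply: le_ereal_inf_tmp => _ [s /= Hs <-]; rewrite lee_fin ler_nat Hmin.
Qed.

Lemma pq_number_infty (R : realType) (n p q : nat) :
  (forall r, ~~ pq_colorable n p q r) -> pq_number R n p q = +oo%E.
Proof.
move=> H; rewrite /pq_number (_ : [set _ | _ in _]%classic = set0).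
  exact: ereal_inf0.
by apply/seteqP; split => // _ [r /= Hr _]; rewrite (negbTE (H r)) in Hr.
Qed.

Lemma pq_colorable_exists (n p q : nat) :
  q <= 'C(p, 2) -> exists r, pq_colorable n p q r.
Proof.
move=> Hq; exists #|edge 'I_n|; apply/existsP.
exists [ffun e => enum_rank e]; apply/forallP => S; apply/implyP => /eqP HS.
apply: (leq_trans Hq); rewrite -HS -cards_draws.
rewrite /colors_in card_in_imset; last first.
  by move=> x y _ _; rewrite !ffunE; exact: enum_rank_inj.
rewrite -[leqRHS](card_imset _ val_inj); apply: subset_leq_card.
apply/fintype.subsetP => A; rewrite inE => /andP[AS A2].
apply/imsetP; exists (Sub A A2 : edge 'I_n); last by rewrite SubK.
by rewrite inE SubK.
Qed.

(* Main.v *)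
Require Import Defs.
From HB Require Import structures.
From mathcomp Require Import all_boot all_order all_algebra.
From mathcomp Require Import all_classical all_reals all_analysis.
From mathcomp Require Import zify.

Import Order.TTheory GRing.Theory Num.Theory.

(** Since ['C(k, 2) = 'C(k - m, 2) + m * (k - m) + 'C(m, 2)], it suffices to find
    [k] vertices spanning at most ['C(k - m, 2) + m] colors.  Pick a vertex, pass
    to its largest monochromatic neighborhood, and repeat [m] times: with [r]
    colors each step shrinks the vertex set by a factor of about [r], and each
    picked vertex sees all the later ones in a single color.  If [n] is at least
    [(k + m) * r ^ m], then [k - m] vertices survive; together with the [m]
    picked ones they span at most ['C(k - m, 2) + m] colors. *)

Lemma card_bigcup_leq (T I : finType) (F : I -> {set T}) :
  #|(\bigcup_i F i)%SET| <= \sum_i #|F i|.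
Proof.
elim/big_ind2: _ => [|m A n B leA leB|//]; first by rewrite cards0.
by apply: leq_trans (leq_card_setU A B) _; apply: leq_add.
Qed.

(** The fibers of [P] over [C] cover [A], so they cannot all have at most [N] elements. *)
Lemma pigeonhole_rel (T C : finType) (P : T -> C -> bool) (A : {set T}) (N : nat) :
  (forall w, w \in A -> exists x, P w x) -> #|C| * N < #|A| ->
  exists x, N < #|[set w in A | P w x]|%SET.
Proof.
move=> AP ltA; apply/existsP; apply: contraLR ltA => /existsPn leN.
rewrite -leqNgt -sum_nat_const.
apply: (leq_trans _ (leq_trans
  (card_bigcup_leq _ _ (fun x => [set w in A | P w x]%SET)) _)).
  apply/subset_leq_card/fintype.subsetP => w wA; have [x Pwx] := AP w wA.
  by apply/bigcupP; exists x; rewrite // inE wA.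
by apply: leq_sum => x _; rewrite leqNgt leN.
Qed.

Lemma bin2_addn (a b : nat) : 'C(a + b, 2) = 'C(a, 2) + b * a + 'C(b, 2).
Proof.
elim: b => [|b IHb]; first by rewrite addn0 bin0n mul0n !addn0.
by rewrite addnS !binS !bin1 IHb; lia.
Qed.

Section FewColors.
Variables (V C : finType) (c : {ffun edge V -> C}).
Implicit Types (S : {set V}) (v w : V) (x : C).

(** A relation instead of a color function on pairs, since there is no edge, hence no color, when
    [v = w]. *)
Definition edge_colored v w x : bool :=
  [exists e : edge V, (val e == [set v; w]%SET) && (c e == x)].

Lemma edge_colored_ex v w : v != w -> exists x, edge_colored v w x.
Proof.
move=> neq_vw; have vw2 : #|[set v; w]%SET| == 2 by rewrite cards2 neq_vw.
pose e : edge V := Sub [set v; w]%SET vw2.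
by exists (c e); apply/existsP; exists e; rewrite SubK !eqxx.
Qed.

Lemma card_colors_in_leq S : #|colors_in c S| <= 'C(#|S|, 2).
Proof.
apply: leq_trans (leq_imset_card _ _) _.
rewrite -cards_draws -(card_imset _ val_inj).
apply/subset_leq_card/fintype.subsetP => _ /imsetP[e eS ->].
by rewrite inE (valP e) andbT; rewrite inE in eS.
Qed.

(** An edge inside [v |: S] either avoids [v], so lies in [S], or joins [v] to some [w] in [S] and
    has color [x]. *)
Lemma colors_in_setU1 v x S :
  (forall w, w \in S -> edge_colored v w x) ->
  colors_in c (v |: S)%SET \subset (x |: colors_in c S)%SET.
Proof.
move=> Sx; apply/fintype.subsetP => y /imsetP[e]; rewrite inE => sub_e ->{y}.
have [ve|ve] := boolP (v \in val e); last first.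
  apply/setU1P; right; apply/imsetP; exists e => //; rewrite inE.
  apply/fintype.subsetP => w we; have := fintype.subsetP sub_e w we.
  by case/setU1P=> // eq_wv; rewrite eq_wv (negPf ve) in we.
have [w wv eq_e] : exists2 w, w != v & val e = [set v; w]%SET.
  have /cards2P[a [b [neq_ab eq_e]]] := valP e.
  move: ve; rewrite eq_e => /set2P[->|->]; first by exists b; rewrite // eq_sym.
  by exists a; rewrite // finset.setUC.
have wS : w \in S.
  have := fintype.subsetP sub_e w; rewrite eq_e set22 => /(_ isT).
  by case/setU1P=> // eq_wv; rewrite eq_wv eqxx in wv.
have /existsP[e' /andP[/eqP eq_e' /eqP ce']] := Sx w wS.
have -> : e = e' by apply: val_inj; rewrite eq_e' eq_e.
by rewrite ce' setU11.
Qed.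

(** Induction on the number [m] of picked vertices: each adds at most one color to those of the
    final [a] vertices, which span at most ['C(a, 2)]. *)
Lemma few_colors_subset (a m : nat) S :
  0 < #|C| -> (a + m.*2) * #|C| ^ m <= #|S| ->
  exists S' : {set V}, [/\ S' \subset S, #|S'| = a + m
    & #|colors_in c S'| <= 'C(a, 2) + m].
Proof.
move=> C0; elim: m S => [|m IHm] S.
  rewrite double0 expn0 muln1 !addn0 => le_aS.
  have [A AS cardA] : exists2 A : {set V}, A \subset S & #|A| = a.
    have : 0 < #|[set A : {set V} | A \subset S & #|A| == a]%SET|.
      by rewrite cards_draws bin_gt0.
    by case/card_gt0P=> A; rewrite inE => /andP[AS /eqP cardA]; exists A.
  by exists A; split; rewrite ?addn0 // -cardA card_colors_in_leq.
move=> leS; have /card_gt0P[v vS] : 0 < #|S|.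
  by apply: leq_trans leS; rewrite muln_gt0 expn_gt0 C0; lia.
have [x ltT] : exists x, (a + m.*2) * #|C| ^ m
    < #|[set w in (S :\ v) | edge_colored v w x]|%SET.
  apply: pigeonhole_rel => [w|].
    by rewrite !inE => /andP[wv _]; apply: edge_colored_ex; rewrite eq_sym.
  (* Passing from [m] to [m.+1] adds 2 to the factor [a + m.*2]: one unit pays for removing [v], the
     other for the strict inequality in the pigeonhole. *)
  move: leS; rewrite (cardsD1 v S) vS mulnCA -expnS.
  have : 0 < #|C| ^ m.+1 by rewrite expn_gt0 C0.
  by rewrite doubleS !addnS !mulSn; lia.
have [S' [S'T cardS' colS']] := IHm _ (ltnW ltT).
have S'P w : w \in S' -> [/\ w != v, w \in S & edge_colored v w x].
  by move/(fintype.subsetP S'T); rewrite !inE -andbA => /and3P.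
exists (v |: S')%SET; split.
- apply/fintype.subsetP => w /setU1P[->//|/S'P[]//].
- by rewrite cardsU1 cardS'; case: (boolP (v \in S')) => [/S'P[/eqP]|] //; lia.
- have := colors_in_setU1 v x S' (fun w wS => let: And3 _ _ h := S'P w wS in h).
  move/subset_leq_card => /leq_trans -> //.
  by rewrite cardsU1; case: (_ \notin _); lia.
Qed.

End FewColors.

Lemma pq_colorable_lower_bound (n k m r : nat) :
  1 <= m <= k - 1 -> 2 <= n ->
  pq_colorable n k ('C(k, 2) - m * (k - m) - 'C(m, 2) + m + 1) r ->
  n <= (k + m) * r ^ m.
Proof.
move=> /andP[m1 mk] n2 /existsP[c /forallP colP].
(* As [2 <= n], there is an edge, and its color shows that the palette is nonempty. *)
have r0 : 0 < #|'I_r|.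
  have neq : Ordinal (ltnW n2) != Ordinal n2 by [].
  have [x _] := edge_colored_ex _ _ c _ _ neq.
  by apply/card_gt0P; exists x.
have le_mk : m <= k by apply: leq_trans mk (leq_subr 1 k).
rewrite leqNgt; apply/negP => ltn.
(* With [a = k - m], the factor [a + m.*2] is [k + m]. *)
have [|S [_ cardS colS]] := few_colors_subset _ _ c (k - m) m [set: 'I_n]%SET r0.
  by rewrite cardsT !card_ord -addnn addnA subnK //; apply: ltnW.
have := colP S; rewrite cardS subnK // eqxx /=.
(* This makes the truncated subtractions exact: the required number of colors is
   ['C(k - m, 2) + m + 1], one more than [S] can have. *)
have -> : 'C(k, 2) = 'C(k - m, 2) + m * (k - m) + 'C(m, 2).
  by rewrite -bin2_addn subnK.
by rewrite subnAC !addnK addn1 ltnNge colS.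
Qed.

Local Open Scope ring_scope.

Lemma powR_natroot_le (R : realType) (n d r m : nat) :
  (0 < m)%N -> (0 < d)%N -> (n <= d * r ^ m)%N ->
  d%:R^-1 `^ m%:R^-1 * n%:R `^ m%:R^-1 <= r%:R :> R.
Proof.
move=> m0 d0 le_n; have m0' : m%:R != 0 :> R by rewrite pnatr_eq0 -lt0n.
rewrite -powRM ?invr_ge0 ?ler0n //.
have -> : r%:R = (r%:R ^+ m) `^ m%:R^-1 :> R.
  by rewrite -powR_mulrn ?ler0n // -powRrM divff // powRr1 ?ler0n.
apply: ge0_ler_powR; rewrite ?nnegrE ?invr_ge0 ?ler0n ?exprn_ge0 //.
by rewrite ler_pdivrMl ?ltr0n // -natrX -natrM ler_nat.
Qed.

Local Close Scope ring_scope.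

Theorem theorem1p3 (R : realType) (k m : nat) (hm1 : 1 <= m) (hmk : m <= k - 1) :
  exists2 c : R, (0 < c)%R &
    \forall n \near \oo%classic,
      ((c * n%:R `^ (m%:R^-1))%R%:E <=
       pq_number R n k ('C(k, 2) - m * (k - m) - 'C(m, 2) + m + 1)%N)%E.
Proof.
have km0 : 0 < k + m by lia.
exists ((k + m)%:R^-1 `^ m%:R^-1)%R.
  by rewrite powR_gt0 // invr_gt0 ltr0n.
(* To bound the infimum from below, bound each admissible [r]; the threshold 2 ensures that an edge
   exists. *)
exists 2 => // n /= n2; apply: le_ereal_inf_tmp => _ [r /= colr <-].
rewrite lee_fin; apply: powR_natroot_le => //.
by apply: pq_colorable_lower_bound colr => //; rewrite hm1.
Qed.
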